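(* Fix real numbers $C,R,L,U>0$ and $0\le s_w<L$. For each integer $n\ge 1$ for which the $(n+1)$-validator checking game with these parameters has a fully mixed symmetric equilibrium, let $\pi_n$ denote the probability with which the Asserter makes a false claim in that equilibrium. Then $\pi_n$ is strictly increasing in $n$: if $1\le n<n'$ are integers for which fully mixed symmetric equilibria exist, then $\pi_n<\pi_{n'}$.
   Context: The $(n+1)$-validator checking game is a one-shot simultaneous-move game. One validator is the Asserter, who chooses to make a false claim or a true claim. Each of the other $n$ validators chooses ''check'' or ''don't check''. A validator who checks always pays cost $C$. The remaining payoffs are as follows. - If the claim is true: the Asserter gets $0$, and every validator gets $0$ (minus $C$ if it checks). - If the claim is false and exactly $m\ge 1$ of the $n$ validators check: the Asserter gets $-R$; each of the $m$ validators that check gets $\frac{R}{m}-C$; each of the other $n-m$ validators gets $-s_w$. - If the claim is false and no validator checks: the Asserter gets $U$ and each of the $n$ validators gets $-L$. A fully mixed symmetric equilibrium is a Nash equilibrium in which the Asserter makes a false claim with probability $\pi\in(0,1)$ and each of the $n$ validators independently checks with the same probability $\alpha\in(0,1)$. Thus the Asserter is indifferent between making a false and a true claim, and each validator is indifferent between checking and not checking (in expected utility). The parameters $C,R,L,U,s_w$ do not vary with $n$. *)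

(* Defs.v *)
From mathcomp Require Import all_boot all_order all_algebra reals.
Set Implicit Arguments.
Unset Strict Implicit.
Unset Printing Implicit Defensive.
Import Order.TTheory GRing.Theory Num.Theory.
Local Open Scope ring_scope.

Section FiniteGame.
Variables (K : realType) (I A : finType).
Implicit Types (u : I -> {ffun I -> A} -> K) (sigma : I -> A -> K).

Definition is_mixed_strategy (tau : A -> K) : Prop :=
  (forall a, 0 <= tau a) /\ \sum_a tau a = 1.

(* The players randomize independently. *)
Definition expected_utility u sigma (i : I) : K :=
  \sum_(a : {ffun I -> A}) (\prod_j sigma j (a j)) * u i a.

Definition nash_equilibrium u sigma : Prop :=
  (forall i, is_mixed_strategy (sigma i)) /\
  (forall i tau, is_mixed_strategy tau ->
     expected_utility u [eta sigma with i |-> tau] i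
       <= expected_utility u sigma i).

End FiniteGame.

Section CheckingGame.
Variables (K : realType) (C R L U sw : K) (n : nat).

(* [None] is the Asserter and [Some j] the j-th other validator.  The action
   [true] means "make a false claim" for the Asserter (so [false] means "make
   a true claim") and "check" for the other validators. *)
Definition player : finType := option 'I_n.

Definition num_checks (a : {ffun player -> bool}) : nat :=
  #|[set j : 'I_n | a (Some j)]|.

Definition asserter_payoff (a : {ffun player -> bool}) : K :=
  if a None then (if num_checks a == 0%N then U else - R) else 0.

Definition validator_payoff (j : 'I_n) (a : {ffun player -> bool}) : K :=
  if a None then
    if num_checks a == 0%N then - L
    else if a (Some j) then R / (num_checks a)%:R - C
    else - sw
  else if a (Some j) then - C else 0.

Definition checking_payoff (i : player) (a : {ffun player -> bool}) : K :=
  if i is Some j then validator_payoff j a else asserter_payoff a.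

Definition bernoulli_strategy (p : K) (b : bool) : K := if b then p else 1 - p.

Definition symmetric_profile (pi alpha : K) (i : player) : bool -> K :=
  bernoulli_strategy (if i is Some _ then alpha else pi).

Definition fully_mixed_symmetric_equilibrium (pi alpha : K) : Prop :=
  [/\ 0 < pi < 1, 0 < alpha < 1
    & nash_equilibrium checking_payoff (symmetric_profile pi alpha)].

End CheckingGame.

(* Main.v *)
(* Write q = 1 - alpha.  The Asserter's indifference reads (U + R) q^n = R, so
   q^n does not depend on n.  With x/0 = 0, the bounty shares a_j/m of the n
   validators add up to 1 - [m = 0] and are exchangeable, so each has expectation
   (1 - q^n)/n, and a validator's indifference becomes
     pi * (R (1 - q^n)/(n alpha) + sw + (L - sw) q^n/q) = C.
   As n grows with q^n fixed, q increases, and n alpha = n (1 - q) does not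
   decrease by AM-GM; hence the bracket decreases and pi increases. *)
Require Import Defs.
From mathcomp Require Import all_boot all_order all_algebra reals.
From mathcomp Require Import perm ring lra.
Set Implicit Arguments.
Unset Strict Implicit.
Unset Printing Implicit Defensive.
Import Order.TTheory GRing.Theory Num.Theory.
Local Open Scope ring_scope.

(** * Expectations of arbitrary functions under independent randomization *)

Section Expectation.
Variables (K : realType) (I A : finType).
Implicit Types (sigma : I -> A -> K) (f g : {ffun I -> A} -> K).

Definition expectation sigma f : K :=
  \sum_(a : {ffun I -> A}) (\prod_j sigma j (a j)) * f a.

Lemma eq_expectation sigma f g : f =1 g -> expectation sigma f = expectation sigma g.
Proof. by move=> fg; apply: eq_bigr => a _; rewrite fg. Qed.

Lemma expectationD sigma f g :
  expectation sigma (fun a => f a + g a) = expectation sigma f + expectation sigma g.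
Proof. by rewrite -big_split; apply: eq_bigr => a _; rewrite mulrDr. Qed.

Lemma expectationZ sigma c f :
  expectation sigma (fun a => c * f a) = c * expectation sigma f.
Proof. by rewrite mulr_sumr; apply: eq_bigr => a _; rewrite mulrCA. Qed.

Lemma expectation_sum (J : finType) sigma (F : J -> {ffun I -> A} -> K) :
  expectation sigma (fun a => \sum_j F j a) = \sum_j expectation sigma (F j).
Proof. by rewrite exchange_big; apply: eq_bigr => a _; rewrite mulr_sumr. Qed.

Lemma expectation_prod sigma (g : I -> A -> K) :
  expectation sigma (fun a => \prod_j g j (a j)) = \prod_j \sum_b sigma j b * g j b.
Proof. by rewrite bigA_distr_bigA; apply: eq_bigr => a _; rewrite -big_split. Qed.

(** Exchangeability: relabelling players who use equal strategies preserves the product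
    distribution. Involutions suffice, since only two validators are swapped later. *)
Lemma expectation_reindex sigma (t : I -> I) f : involutive t ->
  (forall i, sigma (t i) = sigma i) ->
  expectation sigma (fun a => f [ffun i => a (t i)]) = expectation sigma f.
Proof.
move=> tK sigmat.
have hK : involutive (fun a : {ffun I -> A} => [ffun i => a (t i)]).
  by move=> a; apply/ffunP => i; rewrite !ffunE tK.
rewrite /expectation [RHS](reindex_inj (inv_inj hK)) /=.
apply: eq_bigr => a _; congr (_ * _).
rewrite (reindex_inj (inv_inj tK)); apply: eq_bigr => i _.
by rewrite ffunE sigmat.
Qed.

End Expectation.

(** * Indifference between two actions played with positive probability *)

Lemma bernoulli_mixed (K : realType) (p : K) :
  0 <= p <= 1 -> is_mixed_strategy (bernoulli_strategy p).
Proof.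
move=> /andP[p0 p1]; split; last by rewrite big_bool /bernoulli_strategy /=; ring.
by case; rewrite /bernoulli_strategy ?subr_ge0.
Qed.

(** Both sides equal [p * (1 - p)] times the common value of the two actions. Weighting by
    indicators keeps both as expectations under [sigma] itself, so no conditional distribution is
    needed. *)
Lemma nash_indifference (K : realType) (I : finType)
    (u : I -> {ffun I -> bool} -> K) (sigma : I -> bool -> K) (i : I) (p : K) :
  nash_equilibrium u sigma -> sigma i = bernoulli_strategy p -> 0 < p < 1 ->
  (1 - p) * expectation sigma (fun a => (a i)%:R * u i a)
    = p * expectation sigma (fun a => (~~ a i)%:R * u i a).
Proof.
move=> [_ best] sigmai /andP[p0 p1].
(* [W a] is the probability of the opponents' actions in [a], and [V b] the payoff expected from the
   pure action [b] against them. *)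
pose W (a : {ffun I -> bool}) := \prod_(j | j != i) sigma j (a j).
pose V b := \sum_(a : {ffun I -> bool} | a i == b) W a * u i a.
have Eb b : expectation sigma (fun a => (a i == b)%:R * u i a) = bernoulli_strategy p b * V b.
  rewrite /V mulr_sumr [RHS]big_mkcond; apply: eq_bigr => a _.
  rewrite (bigD1 i) //= -/(W a) sigmai; case: eqP => [->|_] /=.
    by rewrite mul1r mulrA.
  by rewrite mul0r mulr0.
have EU tau : expected_utility u [eta sigma with i |-> tau] i = \sum_b tau b * V b.
  rewrite /expected_utility (partition_big (fun a : {ffun I -> bool} => a i) predT) //=.
  apply: eq_bigr => c _; rewrite mulr_sumr; apply: eq_bigr => a /eqP <-.
  rewrite (bigD1 i) //= eqxx mulrA; congr (_ * _ * _).
  by apply: eq_bigr => j /negPf ->.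
have EU0 : expected_utility u sigma i = \sum_b bernoulli_strategy p b * V b.
  rewrite -EU; apply: eq_bigr => a _; congr (_ * _); apply: eq_bigr => j _ /=.
  by case: eqP => [->|]; rewrite ?sigmai.
have pure q : 0 <= q -> q <= 1 -> q * V true + (1 - q) * V false <= p * V true + (1 - p) * V false.
  move=> q0 q1; have /bernoulli_mixed/(best i) : 0 <= q <= 1 by rewrite q0 q1.
  by rewrite EU EU0 !big_bool.
have V1 := pure 1 ler01 (lexx 1); have V0 := pure 0 (lexx 0) ler01.
(* Each inequality comes from one pure deviation; the factor [1 - p] or [p] then cancels because it
   is positive. *)
have eqV : V true = V false.
  apply/eqP; rewrite eq_le; apply/andP; split.
    have : (1 - p) * (V true - V false) <= 0 by lra.
    by rewrite pmulr_rle0 ?subr_gt0 // subr_le0.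
  have : p * (V false - V true) <= 0 by lra.
  by rewrite pmulr_rle0 // subr_le0.
have -> : expectation sigma (fun a => (a i)%:R * u i a) = p * V true.
  by rewrite -(Eb true); apply: eq_expectation => a; rewrite eqb_id.
have -> : expectation sigma (fun a => (~~ a i)%:R * u i a) = (1 - p) * V false.
  by rewrite -(Eb false); apply: eq_expectation => a; rewrite eqbF_neg.
rewrite eqV; ring.
Qed.

(** * Expectations under the symmetric profile and the two indifference equations *)

Section SymmetricProfile.
Variables (K : realType) (n : nat) (pi alpha : K).
Local Notation E := (expectation (@symmetric_profile K n pi alpha)).
Implicit Types (a : {ffun player n -> bool}) (j : 'I_n).

Lemma prod_player (F : player n -> K) : \prod_i F i = F None * \prod_j F (Some j).
Proof.
rewrite (bigD1 None) //=; congr (_ * _).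
rewrite (reindex_omap Some id) /=; last by case.
by apply: eq_bigl => j; rewrite eqxx.
Qed.

Lemma expectation_independent (g : bool -> K) (h : 'I_n -> bool -> K) :
  E (fun a => g (a None) * \prod_j h j (a (Some j))) =
  (pi * g true + (1 - pi) * g false)
    * \prod_j (alpha * h j true + (1 - alpha) * h j false).
Proof.
pose G (i : player n) b := if i is Some j then h j b else g b.
transitivity (E (fun a => \prod_i G i (a i))).
  by apply: eq_expectation => a; rewrite prod_player.
rewrite expectation_prod prod_player big_bool; congr (_ * _).
by apply: eq_bigr => j _; rewrite big_bool.
Qed.

Lemma num_checksE a : num_checks a = (\sum_j a (Some j))%N.
Proof.
rewrite /num_checks -sum1_card big_mkcond; apply: eq_bigr => j _.
by rewrite inE; case: (a _).
Qed.

Lemma unchecked a j : num_checks a = 0%N -> a (Some j) = false.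
Proof.
move=> /eqP; rewrite num_checksE sum_nat_eq0 => /forallP /(_ j).
by case: (a _).
Qed.

(** The product form makes this indicator accessible to [expectation_independent]. *)
Lemma no_checksE a : (num_checks a == 0%N)%:R = \prod_j (~~ a (Some j))%:R :> K.
Proof.
rewrite num_checksE sum_nat_eq0.
case: forallP => [none|some].
  by rewrite big1 // => j _; move: (none j) => /=; case: (a _).
have [j aj] : exists j, a (Some j).
  apply/existsP; apply: contra_notT some => /existsPn none j.
  by rewrite /= (negPf (none j)).
by rewrite (bigD1 j) //= aj mul0r.
Qed.

Lemma expectation_false : E (fun a => (a None)%:R) = pi.
Proof.
transitivity (E (fun a => (a None)%:R * \prod_(j < n) 1)).
  by apply: eq_expectation => a; rewrite big1 ?mulr1.
rewrite (expectation_independent (fun b => b%:R) (fun _ _ => 1)) big1 => [|j _].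
  by rewrite /=; ring.
by ring.
Qed.

Lemma expectation_pair (g h : bool -> K) j :
  E (fun a => g (a None) * h (a (Some j))) =
  (pi * g true + (1 - pi) * g false) * (alpha * h true + (1 - alpha) * h false).
Proof.
pose H (k : 'I_n) b := if k == j then h b else 1.
transitivity (E (fun a => g (a None) * \prod_k H k (a (Some k)))).
  apply: eq_expectation => a; rewrite (bigD1 j) //= /H eqxx big1 ?mulr1 //.
  by move=> k /negPf ->.
rewrite expectation_independent (bigD1 j) //= /H eqxx big1 ?mulr1 //.
by move=> k /negPf ->; ring.
Qed.

Lemma expectation_check j : E (fun a => (a (Some j))%:R) = alpha.
Proof.
transitivity (E (fun a => 1 * (a (Some j))%:R)).
  by apply: eq_expectation => a; rewrite mul1r.
by rewrite (expectation_pair (fun=> 1) (fun b => b%:R)) /=; ring.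
Qed.

Lemma expectation_false_unchecked :
  E (fun a => (a None)%:R * (num_checks a == 0%N)%:R) = pi * (1 - alpha) ^+ n.
Proof.
have := expectation_independent (fun b => b%:R) (fun _ b => (~~ b)%:R).
rewrite [X in _ = _ * X](eq_bigr (fun=> 1 - alpha)) => [|j _]; last by rewrite /=; ring.
rewrite prodr_const card_ord /= mulr0 addr0 mulr1 => <-.
by apply: eq_expectation => a; rewrite no_checksE.
Qed.

Lemma expectation_share j :
  n%:R * E (fun a => (a None)%:R * ((a (Some j))%:R / (num_checks a)%:R))
    = pi * (1 - (1 - alpha) ^+ n).
Proof.
pose S k a : K := (a None)%:R * ((a (Some k))%:R / (num_checks a)%:R).
have exch k : E (S k) = E (S j).
  (* [t] swaps the validators [k] and [j] and fixes the Asserter. *)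
  pose t (i : player n) := omap (tperm k j) i : player n.
  have tK : involutive t by case=> //= i; rewrite /t /= tpermK.
  rewrite -[RHS](expectation_reindex (t := t)) //; last by case.
  apply: eq_expectation => a; rewrite /S !ffunE /= tpermR.
  congr (_ * (_ / _%:R)); rewrite !num_checksE [LHS](reindex_inj (@perm_inj _ (tperm k j))).
  by apply: eq_bigr => i _; rewrite ffunE.
transitivity (E (fun a => \sum_k S k a)).
  rewrite expectation_sum (eq_bigr _ (fun k _ => exch k)) sumr_const card_ord.
  by rewrite mulr_natl.
(* The shares add up to 1 when somebody checks, and to 0 otherwise because 0/0 is 0. *)
transitivity (E (fun a => (a None)%:R + - 1 * ((a None)%:R * (num_checks a == 0%N)%:R))).
  apply: eq_expectation => a; rewrite /S -mulr_sumr -mulr_suml -natr_sum -num_checksE.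
  by case: eqP => [->|/eqP m0]; [|rewrite divff ?pnatr_eq0 //]; rewrite /= ?mul0r; ring.
rewrite expectationD expectationZ expectation_false expectation_false_unchecked; ring.
Qed.

Variables C R L U sw : K.

Lemma asserter_indifference :
  fully_mixed_symmetric_equilibrium C R L U sw n pi alpha ->
  (U + R) * (1 - alpha) ^+ n = R.
Proof.
move=> [pi01 _ nash].
have := nash_indifference (i := None) nash erefl pi01.
set E1 := expectation _ _; set E2 := expectation _ _.
have -> : E1 = pi * ((U + R) * (1 - alpha) ^+ n - R).
  transitivity (E (fun a => (U + R) * ((a None)%:R * (num_checks a == 0%N)%:R)
                            + - R * (a None)%:R)).
    apply: eq_expectation => a; rewrite /= /asserter_payoff.
    by case: (a None); case: (_ == _); rewrite /=; ring.
  rewrite expectationD !expectationZ expectation_false_unchecked expectation_false; ring.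
(* [E2] collects only true claims, which pay the Asserter 0. *)
have -> : E2 = 0.
  apply: big1 => a _; rewrite /= /asserter_payoff.
  by case: (a None); rewrite /= ?mul0r !mulr0.
rewrite mulr0 => /eqP; move: pi01 => /andP[pi0 pi1].
by rewrite !mulf_eq0 !subr_eq0 (gt_eqF pi1) (gt_eqF pi0) => /eqP.
Qed.

Lemma validator_indifference : (0 < n)%N ->
  fully_mixed_symmetric_equilibrium C R L U sw n pi alpha ->
  pi * (R * (1 - (1 - alpha) ^+ n) / (n%:R * alpha) + sw
        + (L - sw) * (1 - alpha) ^+ n / (1 - alpha)) = C.
Proof.
move=> n0 [_ alpha01 nash]; pose j := Ordinal n0.
have := nash_indifference (i := Some j) nash erefl alpha01.
set E1 := expectation _ _; set E2 := expectation _ _.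
have nK0 : n%:R != 0 :> K by rewrite pnatr_eq0 -lt0n.
have -> : E1 = R * (pi * (1 - (1 - alpha) ^+ n) / n%:R) - C * alpha.
  rewrite -(expectation_share j) mulrAC divff // mul1r.
  transitivity (E (fun a =>
      R * ((a None)%:R * ((a (Some j))%:R / (num_checks a)%:R)) + - C * (a (Some j))%:R)).
    apply: eq_expectation => a; rewrite /= /validator_payoff.
    case: eqP => [m0|_].
      by rewrite (unchecked j m0); case: (a None); rewrite /=; ring.
    by case: (a None); case: (a (Some j)); rewrite /=; ring.
  by rewrite expectationD !expectationZ expectation_check mulNr.
(* Not checking a false claim costs [sw], and a further [L - sw] when nobody else checks either. *)
have -> : E2 = - (pi * (sw * (1 - alpha) + (L - sw) * (1 - alpha) ^+ n)).
  transitivity (E (fun a => - sw * ((a None)%:R * (~~ a (Some j))%:R)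
      + - (L - sw) * ((a None)%:R * (num_checks a == 0%N)%:R))).
    apply: eq_expectation => a; rewrite /= /validator_payoff.
    case: eqP => [m0|_].
      by rewrite (unchecked j m0); case: (a None); rewrite /=; ring.
    by case: (a None); case: (a (Some j)); rewrite /=; ring.
  rewrite expectationD !expectationZ expectation_false_unchecked.
  rewrite (expectation_pair (fun b => b%:R) (fun b => (~~ b)%:R)) /=; ring.
move: alpha01 => /andP[a0 a1] eqE.
have aN0 : alpha != 0 by rewrite gt_eqF.
have qN0 : 1 - alpha != 0 by rewrite subr_eq0 gt_eqF.
(* Multiplying the goal by this factor turns it into the weighted indifference [eqE]. *)
have aqN0 : (1 - alpha) * alpha != 0 by rewrite mulf_neq0.
apply: (mulfI aqN0).
transitivity ((1 - alpha) * (R * (pi * (1 - (1 - alpha) ^+ n) / n%:R))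
   + alpha * (pi * (sw * (1 - alpha) + (L - sw) * (1 - alpha) ^+ n))); last first.
  by lra.
by set x := _ ^+ n; field; rewrite nK0 aN0 qN0.
Qed.

End SymmetricProfile.

(** * Comparison of two numbers of validators *)

Lemma eq_expr_lt (K : realType) (n m : nat) (q r : K) :
  (n < m)%N -> 0 < q -> 0 < r < 1 -> q ^+ n = r ^+ m -> q < r.
Proof.
move=> nm q0 /andP[r0 r1] eqn; rewrite ltNge; apply/negP => rq.
(* If [r <= q], then [r ^+ m < r ^+ n <= q ^+ n], against the assumed equality. *)
suff : r ^+ m < q ^+ n by rewrite eqn ltxx.
apply: (lt_le_trans (y := r ^+ n)); first by rewrite ltr_iXn2l.
by rewrite lerXn2r // nnegrE ltW.
Qed.

(* AM-GM for [n] copies of [q] and [m - n] copies of [1]. *)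
Lemma eq_expr_mean (K : realType) (n m : nat) (q r : K) :
  (n < m)%N -> 0 < q -> 0 < r -> q ^+ n = r ^+ m ->
  n%:R * (1 - q) <= m%:R * (1 - r).
Proof.
move=> nm q0 r0 eqn.
pose F (i : 'I_m) : K := if (i < n)%N then q else 1.
have F0 : {in predT, forall i, 0 <= F i} by move=> i _; rewrite /F; case: ifP; rewrite ?ler01 ?ltW.
have m0 : (0 < m)%N by apply: leq_ltn_trans nm.
have nle : (n <= m)%N by apply: ltnW.
have prodF : \prod_(i in predT) F i = r ^+ m.
  by rewrite -eqn -big_mkcond /= -(big_ord_widen m (fun=> q)) // prodr_const card_ord.
have sumF : \sum_(i in predT) F i = m%:R - n%:R * (1 - q).
  transitivity (\sum_(i < m) (1 - (if (i < n)%N then 1 - q else 0))).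
    by apply: eq_bigr => i _; rewrite /F; case: ifP => _; ring.
  rewrite big_split /= sumr_const card_ord sumrN -big_mkcond /=.
  by rewrite -(big_ord_widen m (fun=> 1 - q)) // sumr_const card_ord !mulr_natl.
have := (leif_AGM F0).1.
(* The mean must be nonnegative for the exponent [m] to be removed from both sides of AM-GM. *)
have mu0 : 0 <= (m%:R - n%:R * (1 - q)) / m%:R.
  by rewrite -sumF divr_ge0 ?ler0n //; apply: sumr_ge0 => i; apply: F0.
rewrite prodF sumF card_ord ler_pXn2r ?nnegrE ?(ltW r0) //.
rewrite ler_pdivlMr ?ltr0n //; lra.
Qed.

Theorem proposition2 (K : realType) (C R L U sw : K)
  (hC : 0 < C) (hR : 0 < R) (hL : 0 < L) (hU : 0 < U)
  (hsw0 : 0 <= sw) (hswL : sw < L)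
  (n n' : nat) (hn : (1 <= n)%N) (hnn' : (n < n')%N)
  (pi alpha pi' alpha' : K)
  (heq : fully_mixed_symmetric_equilibrium C R L U sw n pi alpha)
  (heq' : fully_mixed_symmetric_equilibrium C R L U sw n' pi' alpha') :
  pi < pi'.
Proof.
have n'0 : (0 < n')%N by apply: leq_ltn_trans hnn'.
have eqa := asserter_indifference heq; have eqa' := asserter_indifference heq'.
have eqv := validator_indifference hn heq.
have eqv' := validator_indifference n'0 heq'.
case: heq heq' => /andP[p0 _] /andP[a0 a1] _ [/andP[p'0 _] /andP[a'0 a'1] _].
have UR0 : U + R != 0 by rewrite gt_eqF ?addr_gt0.
have eqq : (1 - alpha) ^+ n = (1 - alpha') ^+ n' by apply: (mulfI UR0); rewrite eqa eqa'.
have q0 : 0 < 1 - alpha by lra.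
have q'0 : 0 < 1 - alpha' by lra.
have q'1 : 0 < 1 - alpha' < 1 by apply/andP; split; lra.
have ltq := eq_expr_lt hnn' q0 q'1 eqq.
have mean := eq_expr_mean hnn' q0 q'0 eqq.
(* Now [mean] compares the expected numbers of checkers: [n%:R * alpha <= n'%:R * alpha']. *)
rewrite !subKr in mean.
have rho0 : 0 < (1 - alpha) ^+ n by rewrite exprn_gt0.
have rho1 : (1 - alpha) ^+ n < 1 by rewrite exprn_ilt1 ?ltW -?lt0n //; lra.
move: eqv eqv'; rewrite -eqq; set rho := _ ^+ n in rho0 rho1 *.
set D := (_ + _ + _); set D' := (_ + _ + _) => eqv eqv'.
have num0 : 0 < R * (1 - rho) by rewrite mulr_gt0 ?subr_gt0.
have na0 : 0 < n%:R * alpha by rewrite mulr_gt0 ?ltr0n.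
(* The bounty term decreases weakly by [mean]; strictness comes from the last term, by [ltq],
   [sw < L] and [0 < rho]. *)
have D'_lt : D' < D.
  rewrite /D /D' ler_ltD //.
    by rewrite lerD2r ler_pM2l // lef_pV2 // posrE // (lt_le_trans na0).
  by rewrite ltr_pM2l ?mulr_gt0 ?subr_gt0 // ltf_pV2.
(* Positivity follows from [pi' * D' = C > 0]. Then [pi * D' < pi * D = C = pi' * D'], and [D']
   cancels. *)
have D'0 : 0 < D' by rewrite -(pmulr_rgt0 _ p'0) eqv'.
rewrite -(ltr_pM2r D'0) eqv' -eqv ltr_pM2l //.
Qed.
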